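(* Let $\mu>0$. Suppose $\theta:\mathcal X^n\to\mathbb R^p$ is a multivariate statistic with rank-deficient sensitivity space, i.e. $d_\theta<p$, and $\Delta_2(\theta;\mathcal X^n)=\Delta_2>0$ (finite). Let the columns of $U_\theta$ (used to define $M_{rJS}$) be any orthonormal basis of $\mathrm{span}(\mathcal S_\theta)$. Suppose $M_G$, $M_r$ and $M_{rJS}$ are calibrated to satisfy $\mu$-GDP, i.e. with $\sigma=\Delta_2/\mu$. Then $M_r$ strictly dominates $M_G$. If $d_\theta\ge4$, then $M_{rJS}$ strictly dominates each of $M_r$ and $M_G$.
   Context: $\mathcal X$ is a sample space; $S,S'\in\mathcal X^n$ are neighbors ($S\sim S'$) if they differ in exactly one record. $\Delta_2(\theta;\mathcal X^n)=\sup_{S\sim S'}\|\theta(S)-\theta(S')\|_2$. The sensitivity space is $\mathcal S_\theta=\{\theta(S)-\theta(S'):S\sim S'\}$ and $d_\theta=\dim(\mathrm{span}(\mathcal S_\theta))$; $\mathcal S_\theta$ is rank-deficient if $d_\theta<p$. Let $U_\theta$ ($p\times d_\theta$) and $U_1$ ($p\times(p-d_\theta)$) have columns forming orthonormal bases of $\mathrm{span}(\mathcal S_\theta)$ and of its orthogonal complement, respectively; $U_\theta$ does not depend on the data set $S$. For $\sigma>0$: $M_G(S)=\theta(S)+N_p(0,\sigma^2I_p)$; $M_r(S)=\theta(S)+N_p(0,\sigma^2U_\theta U_\theta^\top)$ (the rank-deficient Gaussian mechanism); $M_{rJS}(S)=U_1U_1^\top\theta(S)+U_\theta\, m_a(U_\theta^\top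 M_r(S);\sigma)$ (the rank-deficient James–Stein mechanism). Here, for $x\in\mathbb R^d$, $m_a(x;\sigma)=\bar x\mathbf 1_d+\Big(1-\frac{(d-3)\sigma^2}{\|x_c\|_2^2}\Big)x_c$ with $\bar x=d^{-1}\mathbf 1_d^\top x$ and $x_c=x-\bar x\mathbf 1_d$ (used with $d=d_\theta$). $L_2(M(S))=\mathbb E\|M(S)-\theta(S)\|_2^2$, expectation over the randomness of $M$ with $S$ fixed. $M$ strictly dominates $M'$ if $L_2(M(S))<L_2(M'(S))$ for every $S\in\mathcal X^n$. *)

(* Defs.v *)
From HB Require Import structures.
From mathcomp Require Import all_boot all_order all_algebra.
From mathcomp Require Import all_classical all_reals all_analysis.
From mathcomp Require Import measurable_realfun.

Set Implicit Arguments.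
Unset Strict Implicit.
Unset Printing Implicit Defensive.

Import Order.TTheory GRing.Theory Num.Theory.
Import numFieldNormedType.Exports.

Local Open Scope classical_set_scope.
Local Open Scope ring_scope.

Section Span.
Context {K : fieldType} {vT : vectType K}.
Implicit Types (A : set vT) (V W : {vspace vT}).

Definition is_span A V : Prop :=
  (forall v, A v -> v \in V) /\
  (forall W, (forall v, A v -> v \in W) -> (V <= W)%VS).

(* The library's [span] only applies to finite sequences of vectors, whereas a
   sensitivity space may be infinite. *)
Definition spanS A : {vspace vT} := xget 0%VS (is_span A).

Lemma spanSP A : is_span A (spanS A).
Proof.
pose P m := `[< exists2 s : seq vT, (forall v, v \in s -> A v) & \dim << s >> = m >].
have exP : exists m, P m by exists 0%N; apply/asboolP; exists [::] => //; rewrite span_nil dimv0.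
have ubP m : P m -> (m <= \dim {:vT})%N.
  by move=> /asboolP[s _ <-]; exact: dimvS (subvf _).
case: (ex_maxnP exP ubP) => m /asboolP[s sA sm] maxm.
apply: (@xgetPex _ 0%VS (is_span A)); exists << s >>%VS; split.
- move=> v Av; have sub : (<< s >> <= <<v :: s>>)%VS.
    by rewrite span_cons addvSr.
  have eqd : \dim <<v :: s>> = m.
    apply/eqP; rewrite eqn_leq -{2}sm dimvS // andbT; apply: maxm.
    apply/asboolP; exists (v :: s) => // w.
    by rewrite in_cons => /orP[/eqP->//|/sA].
  have /eqP -> : (<< s >> == <<v :: s>>)%VS by rewrite eqEdim sub eqd sm leqnn.
  by apply: memv_span; rewrite mem_head.
- by move=> W AW; apply/span_subvP => v /sA; exact: AW.
Qed.

End Span.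

Section EuclideanSpace.
Context {R : realType} {p : nat}.
Implicit Types (x y v : 'cV[R]_p) (V : {vspace 'cV[R]_p}).

(* The norm that the library puts on matrices is the sup norm, so the Euclidean
   norm has to be introduced separately. *)
Definition l2norm x : R := Num.sqrt (\sum_(i < p) x i 0 ^+ 2).

Lemma l2normK x : l2norm x ^+ 2 = \sum_(i < p) x i 0 ^+ 2.
Proof. by rewrite sqr_sqrtr// sumr_ge0// => i _; rewrite sqr_ge0. Qed.

Definition orthocomp V : {vspace 'cV[R]_p} :=
  (\bigcap_(i < \dim V) lker (linfun (mulmx ((vbasis V)`_i)^T : 'cV[R]_p -> 'M[R]_1)))%VS.

Lemma mem_orthocomp V x :
  x \in orthocomp V <-> forall v, v \in V -> v^T *m x = 0.
Proof.
rewrite memvE; split=> [/subv_bigcapP xV v vV|xV].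
  rewrite (coord_vbasis vV) linear_sum mulmx_suml big1// => i _.
  have := xV i isT; rewrite -memvE memv_ker lfunE /= => /eqP h.
  by rewrite linearZ -scalemxAl h scaler0.
apply/subv_bigcapP => i _; rewrite -memvE memv_ker lfunE /=.
by apply/eqP/xV; rewrite vbasis_mem// memt_nth.
Qed.

(* [U^T *m U = 1%:M] says that the columns of U are orthonormal. *)
Definition orthonormal_basis k (U : 'M[R]_(p, k)) V : Prop :=
  basis_of V [tuple col j U | j < k] /\ U^T *m U = 1%:M.

End EuclideanSpace.

Section MeasurableColumnVectors.
Context {R : realType}.

Definition cV_coord n (i : 'I_n) (x : 'cV[R]_n) : R := x i 0.

Definition cV_display : measure_display.
Proof. exact. Qed.

Variable n : nat.

Let cV_set0 : g_sigma_preimage (@cV_coord n) set0.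
Proof. exact: sigma_algebra0. Qed.

Let cV_setC A : g_sigma_preimage (@cV_coord n) A ->
  g_sigma_preimage (@cV_coord n) (~` A).
Proof. exact: sigma_algebraC. Qed.

Let cV_bigcup (F : _^nat) : (forall i, g_sigma_preimage (@cV_coord n) (F i)) ->
  g_sigma_preimage (@cV_coord n) (\bigcup_i (F i)).
Proof. exact: sigma_algebra_bigcup. Qed.

(* The Borel sigma-algebra of R^n, presented as the product sigma-algebra, as
   the library does for tuples. *)
HB.instance Definition _ := @isMeasurable.Build cV_display
  'cV[R]_n (g_sigma_preimage (@cV_coord n)) cV_set0 cV_setC cV_bigcup.

End MeasurableColumnVectors.

Section MeasurableFunctions.
Context {R : realType} {d : measure_display} {T : measurableType d}.

Lemma measurable_cVP n (f : T -> 'cV[R]_n) :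
  measurable_fun [set: T] f <->
  forall i, measurable_fun [set: T] (fun t => f t i 0).
Proof.
apply: (@iff_trans _ (g_sigma_preimage
    (fun i => @cV_coord R n i \o f) `<=` measurable)).
  rewrite g_sigma_preimage_comp; split=> [mf A [/= C preC <-]|prefS].
    exact: mf.
  by move=> _ A mA; apply: prefS; exists A.
split=> [crdfS i|mf].
- move=> _ A mA.
  apply: crdfS; apply: sub_sigma_algebra.
  case: n i => [[] []//|n i] in f *.
  rewrite -bigcup_mkord_ord.
  exists i; first exact: ltn_ord.
  by exists A => //; rewrite inord_val.
- apply: smallest_sub; first exact: sigma_algebra_measurable.
  case: n => [|n] in f mf *; first by rewrite big_ord0.
  rewrite -bigcup_mkord_ord; apply: bigcup_sub => i Ii.
  by move=> A [B mB <-]; exact: mf.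
Qed.

Lemma measurable_cV_add n (f g : T -> 'cV[R]_n) :
  measurable_fun [set: T] f -> measurable_fun [set: T] g ->
  measurable_fun [set: T] (fun t => f t + g t).
Proof.
move=> /measurable_cVP mf /measurable_cVP mg; apply/measurable_cVP => i.
under eq_fun do rewrite mxE.
exact: measurable_funD.
Qed.

Lemma measurable_cV_mulmx m n (A : 'M[R]_(m, n)) (f : T -> 'cV[R]_n) :
  measurable_fun [set: T] f -> measurable_fun [set: T] (fun t => A *m f t).
Proof.
move=> /measurable_cVP mf; apply/measurable_cVP => i.
under eq_fun do rewrite mxE.
by apply: measurable_sum => j; apply: measurable_funM.
Qed.

Lemma measurable_cV_scale n (a : T -> R) (f : T -> 'cV[R]_n) :
  measurable_fun [set: T] a -> measurable_fun [set: T] f ->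
  measurable_fun [set: T] (fun t => a t *: f t).
Proof.
move=> ma /measurable_cVP mf; apply/measurable_cVP => i.
under eq_fun do rewrite mxE.
exact: measurable_funM.
Qed.

End MeasurableFunctions.

Section NormalDistribution.
Context {R : realType}.

Definition consV n (x : measurableTypeR R * 'cV[R]_n) : 'cV[R]_n.+1 :=
  \col_i (if unlift ord0 i is Some j then x.2 j 0 else x.1).

Let measurable_consV n : measurable_fun [set: _] (@consV n).
Proof.
apply/measurable_cVP => i; under eq_fun do rewrite mxE.
case: (unlift ord0 i) => [j|]; last exact: measurable_fst.
by have /measurable_cVP := @measurable_snd _ _ (measurableTypeR R) 'cV[R]_n; exact.
Qed.

HB.instance Definition _ n :=
  isMeasurableFun.Build _ _ _ _ (@consV n) (@measurable_consV n).

(* The law N_n(0, I_n): the product of n copies of N(0, 1), see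
   [std_normal_box]. *)
Fixpoint std_normal n : probability 'cV[R]_n R :=
  match n with
  | 0 => \d_(0 : 'cV[R]_0)
  | m.+1 => distribution (normal_prob 0 1 \x std_normal m)%E (@consV m)
  end.

Lemma std_normal_box n (A : 'I_n -> set (measurableTypeR R)) :
  (forall i, measurable (A i)) ->
  std_normal n [set x | forall i, A i (x i 0)] =
  (\prod_(i < n) normal_prob 0 1 (A i))%E.
Proof.
elim: n A => [|n IH] A mA.
  rewrite big_ord0 /= diracE.
  by rewrite mem_set//= => -[].
rewrite big_ord_recl /= /distribution /pushforward.
rewrite -IH; last by move=> i; exact: mA.
have mbox : measurable [set x : 'cV[R]_n | forall i, A (lift ord0 i) (x i 0)].
  rewrite (_ : [set _ | _] =
    \bigcap_(i in [set: 'I_n]) ((fun x : 'cV[R]_n => x i 0) @^-1` A (lift ord0 i))).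
    apply: fin_bigcap_measurable => //= i _.
    rewrite -[X in measurable X]setTI.
    have /measurable_cVP := @measurable_id _ 'cV[R]_n setT.
    by move=> /(_ i); apply => //; exact: mA.
  by apply/seteqP; split=> x /= h i; [move=> _|]; exact: h.
rewrite -product_measure1E//=.
congr (_ _); apply/seteqP; split=> -[a x]/=.
- move=> h; split=> [|i].
    by have := h ord0; rewrite mxE unlift_none.
  by have := h (lift ord0 i); rewrite mxE liftK.
- by move=> [h0 h] i; rewrite mxE; case: unliftP => [j|] -> /=.
Qed.

Definition affine m n (c : 'cV[R]_m) (A : 'M[R]_(m, n)) (x : 'cV[R]_n) :
  'cV[R]_m := c + A *m x.

Let measurable_affine m n c A : measurable_fun [set: _] (@affine m n c A).
Proof.
apply: measurable_cV_add; first exact: measurable_cst.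
by apply: measurable_cV_mulmx; exact: measurable_id.
Qed.

HB.instance Definition _ m n c A :=
  isMeasurableFun.Build _ _ _ _ (@affine m n c A) (@measurable_affine m n c A).

Definition translate n (c x : 'cV[R]_n) : 'cV[R]_n := c + x.

Let measurable_translate n c : measurable_fun [set: _] (@translate n c).
Proof. exact: measurable_cV_add. Qed.

HB.instance Definition _ n c :=
  isMeasurableFun.Build _ _ _ _ (@translate n c) (@measurable_translate n c).

Definition psdmx n (A : 'M[R]_n) : Prop :=
  A^T = A /\ forall x : 'cV[R]_n, 0 <= (x^T *m A *m x) 0 0.

(* The positive semidefinite square root, which exists and is unique when A is
   positive semidefinite; the value for other A is irrelevant. *)
Definition sqrtmx n (A : 'M[R]_n) : 'M[R]_n :=
  xget 0 [set B | psdmx B /\ B *m B = A].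

(* N_n(m, Sigma), for a possibly singular covariance Sigma, is the law of
   m + Sigma^(1/2) Z with Z distributed as N_n(0, I_n). *)
Definition multinormal n (m : 'cV[R]_n) (Sigma : 'M[R]_n) :
    probability 'cV[R]_n R :=
  distribution (std_normal n) (affine m (sqrtmx Sigma)).

End NormalDistribution.

Section MeanShrinkage.
Context {R : realType} {d : nat}.
Implicit Types x : 'cV[R]_d.

Definition meanV x : R := d%:R^-1 * \sum_(i < d) x i 0.

Definition centerV x : 'cV[R]_d := x - meanV x *: const_mx 1.

(* When x = meanV x *: const_mx 1 the shrinkage factor divides by 0; the value
   of [m_a] is then meanV x *: const_mx 1, because [centerV x] is 0. *)
Definition m_a (sigma : R) x : 'cV[R]_d :=
  meanV x *: const_mx 1 +
  (1 - (d%:R - 3) * sigma ^+ 2 / l2norm (centerV x) ^+ 2) *: centerV x.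


Lemma measurable_m_a sigma : measurable_fun [set: _] (m_a sigma).
Proof.
have m1 : measurable_fun [set: 'cV[R]_d] meanV.
  apply: measurable_funM => //; apply: measurable_sum => i.
  by have /measurable_cVP := @measurable_id _ 'cV[R]_d setT; exact.
have mc : measurable_fun [set: 'cV[R]_d] centerV.
  rewrite /centerV; under eq_fun do rewrite -scaleNr.
  apply: measurable_cV_add; first exact: measurable_id.
  apply: measurable_cV_scale => //.
  exact: measurable_funN.
apply: measurable_cV_add; first exact: measurable_cV_scale.
apply: measurable_cV_scale => //.
apply: measurable_funB => //; apply: measurable_funM => //.
under eq_fun do rewrite -powR_inv1 ?sqr_ge0//.
apply: (measurableT_comp (measurable_powR _)).
under eq_fun do rewrite l2normK.
apply: measurable_sum => i; apply: measurable_funX.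
by move/measurable_cVP : mc; exact.
Qed.

End MeanShrinkage.

Section Sensitivity.
Context {R : realType} {X : Type} {n p : nat}.
Variable theta : n.-tuple X -> 'cV[R]_p.

Definition neighbors (S S' : n.-tuple X) : Prop :=
  exists i, tnth S i <> tnth S' i /\
    forall j, j != i -> tnth S j = tnth S' j.

(* This is -oo when there are no neighbors. *)
Definition l2_sensitivity : \bar R :=
  ereal_sup [set r | exists S S',
    neighbors S S' /\ r = (l2norm (theta S - theta S'))%:E].

Definition sensitivity_space : set 'cV[R]_p :=
  [set v | exists S S', neighbors S S' /\ v = theta S - theta S'].

Definition sensitivity_span : {vspace 'cV[R]_p} := spanS sensitivity_space.

Definition sensitivity_dim : nat := \dim sensitivity_span.

End Sensitivity.

Section Mechanisms.
Context {R : realType} {X : Type} {n p : nat}.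
Variable theta : n.-tuple X -> 'cV[R]_p.

(* A mechanism is represented by the law of its output on each data set. *)
Definition mechanism := n.-tuple X -> probability 'cV[R]_p R.

Definition L2 (M : mechanism) (S : n.-tuple X) : \bar R :=
  'E_(M S)[fun y => l2norm (y - theta S) ^+ 2].

Definition strictly_dominates (M M' : mechanism) : Prop :=
  forall S, (L2 M S < L2 M' S)%E.

Definition M_G (sigma : R) : mechanism := fun S =>
  distribution (multinormal 0 (sigma ^+ 2 *: 1%:M)) (translate (theta S)).

Definition M_r d (U : 'M[R]_(p, d)) (sigma : R) : mechanism := fun S =>
  distribution (multinormal 0 (sigma ^+ 2 *: (U *m U^T))) (translate (theta S)).

Definition rJS_post d k (U : 'M[R]_(p, d)) (U1 : 'M[R]_(p, k)) (sigma : R)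
    (S : n.-tuple X) (y : 'cV[R]_p) : 'cV[R]_p :=
  U1 *m U1^T *m theta S + U *m m_a sigma (U^T *m y).

Let measurable_rJS_post d k (U : 'M[R]_(p, d)) (U1 : 'M[R]_(p, k)) sigma S :
  measurable_fun [set: _] (rJS_post U U1 sigma S).
Proof.
apply: measurable_cV_add => //; apply: measurable_cV_mulmx.
apply: (measurableT_comp (measurable_m_a _)).
exact: measurable_cV_mulmx.
Qed.

HB.instance Definition _ d k U U1 sigma S :=
  isMeasurableFun.Build _ _ _ _ (@rJS_post d k U U1 sigma S)
    (@measurable_rJS_post d k U U1 sigma S).

(* The noise in [rJS_post] comes only from its last argument, which is drawn
   from the law [M_r U sigma S]. *)
Definition M_rJS d k (U : 'M[R]_(p, d)) (U1 : 'M[R]_(p, k)) (sigma : R) :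
  mechanism := fun S => distribution (M_r U sigma S) (rJS_post U U1 sigma S).

End Mechanisms.

(* Main.v *)
(* All three risks are expectations over Z ~ N_p(0, I_p). The two Gaussian
   mechanisms have risk the trace of their covariance, sigma^2 p and
   sigma^2 d_theta. Put W = U_theta^T Sigma^(1/2), so that W W^T = sigma^2 I;
   since U_theta U_theta^T + U_1 U_1^T = I, the loss of M_rJS is that of m_a
   applied to x + W Z with x = U_theta^T theta(S). Let A be W followed by
   centering, v = (x + W Z)_c, q = |v|^2 and c = d_theta - 3. To avoid proving
   that 1/q is integrable, 1/q is replaced by 1/(q + e): Stein's identity,
   applied to each coordinate of Z and the bounded field A^T v / (q + e), bounds
   the regularized risk by sigma^2 d_theta - c^2 sigma^4 E[1/(q + 1)] for every
   0 < e <= 1, and Fatou's lemma passes to the limit e -> 0. Using Stein's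
   identity in the coordinates of Z, rather than of W Z, makes the rotation
   invariance of N_p(0, I_p) unnecessary. *)
Require Import Defs.
From mathcomp Require Import all_boot all_order all_algebra.
From mathcomp Require Import all_classical all_reals all_analysis.
From mathcomp Require Import measurable_realfun ring lra.

Set Implicit Arguments.
Unset Strict Implicit.
Unset Printing Implicit Defensive.

Import Order.TTheory GRing.Theory Num.Theory.
Import numFieldNormedType.Exports.

Local Open Scope ring_scope.
Local Open Scope classical_set_scope.

(** * Stein's identity on the real line *)

Section OneDimensionalGaussian.
Context {R : realType}.
Local Notation mu := (@lebesgue_measure R).
Local Notation N := (@normal_prob R 0 1).
Local Notation pdf := (@normal_pdf R 0 1).
Implicit Types F G : R -> R.

(** The density is a version of the Radon-Nikodym derivative, so the two integrands agree almost
    everywhere. Integrability replaces nonnegativity because Stein's integrand changes sign. *)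
Lemma integral_normal_prob (m s : R) (f : R -> \bar R) (U : set R) :
  measurable U -> (normal_prob m s).-integrable U f ->
  (\int[normal_prob m s]_(x in U) f x =
   \int[mu]_(x in U) (f x * (normal_pdf m s x)%:E))%E.
Proof.
move=> mU If; have mf := measurable_int _ If.
have mpdf := measurable_normal_pdf m s.
rewrite -(Radon_Nikodym_change_of_variables (normal_prob_dominates m s))//=.
apply: ae_eq_integral => //.
- apply: emeasurable_funM => //; apply: (measurable_int mu).
  apply: (integrableS _ _ (@subsetT _ _)) => //=.
  by apply: Radon_Nikodym_integrable; exact: normal_prob_dominates.
- apply: emeasurable_funM => //=; apply/measurable_EFinP.
  exact: measurable_funTS.
- apply: ae_eqe_mul2l => /=.
  rewrite Radon_NikodymE//=; first exact: normal_prob_dominates.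
  move=> dom; case: cid => /= h [h1 h2 h3].
  apply: integral_ae_eq => //=.
  + exact: integrableS h2.
  + by apply/measurable_EFinP; exact: measurable_funTS.
  + by move=> E EU mE; rewrite -h3.
Qed.

Lemma is_derive_normal_pdf01 (x : R) : is_derive x 1 pdf (- x * pdf x).
Proof.
have -> : pdf = normal_peak 1 \*: (expR \o ((- 2^-1) \*: (id ^+ 2))).
  apply/funext => y; rewrite normal_pdfE ?oner_neq0//= /normal_fun subr0 expr1n.
  by congr (_ * expR _); rewrite mulNr mulrC -mulNr.
apply: is_derive_eq; rewrite /GRing.scale/=.
set e := expR _; have -> : normal_peak 1 *: e = normal_peak 1 * e by [].
by field.
Qed.

(** This is 1 + t <= exp t at t = x^2 / 2. The resulting quadratic decay of the density is enough to
    beat linear growth in the boundary terms. *)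
Lemma normal_pdf01_le (x : R) : pdf x * (1 + x ^+ 2 / 2) <= normal_peak 1.
Proof.
rewrite normal_pdfE ?oner_neq0// -mulrA ler_piMr ?normal_peak_ge0//.
rewrite /normal_fun subr0 expr1n mulNr expRN mulrC ler_pdivrMr ?expR_gt0//.
by rewrite mul1r; exact: expR_ge1Dx.
Qed.

Lemma integrable_normal_itv (f : R -> R) (a b : R) : continuous f ->
  N.-integrable `[a, b] (EFin \o f).
Proof.
move=> cf; apply: measurable_bounded_integrable => //=.
- by rewrite (le_lt_trans (probability_le1 _ _))// ltry.
- by apply: measurable_funTS; exact: continuous_measurable_fun.
- have /compact_bounded[M [Mreal Mub]] : compact (f @` `[a, b]).
    apply: continuous_compact; first exact: continuous_subspaceT.
    exact: segment_compact.
  by exists M; split => // r Mr x abx; apply: (Mub r Mr); exists x.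
Qed.

(** Since phi'(x) = - x phi(x) for the density phi, the integrand times phi is the derivative of - F
    phi, and the fundamental theorem of calculus leaves only the boundary terms. *)
Lemma integral_itv_stein F G (a b : R) : a < b ->
  (forall x : R, is_derive x 1 F (G x)) -> continuous G ->
  (\int[N]_(x in `[a, b]) (x * F x - G x)%:E =
   (F a * pdf a - F b * pdf b)%:E)%E.
Proof.
move=> ab dF cG.
have cF : continuous F.
  move=> x; apply: differentiable_continuous; apply/derivable1_diffP.
  by have [] := dF x.
have ch : continuous (fun x : R => x * F x - G x).
  move=> x; apply: cvgB; last exact: cG.
  by apply: cvgM; [exact: cvg_id|exact: cF].
have cpdf : continuous pdf by apply: continuous_normal_pdf; exact: oner_neq0.
rewrite integral_normal_prob//; last exact: integrable_normal_itv.
under eq_integral do rewrite -EFinM.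
have dFp (x : R) : is_derive x 1 (fun x : R => - (F x * pdf x)) ((x * F x - G x) * pdf x).
  have := is_derive_normal_pdf01 x => dpdf; have dFx := dF x.
  apply: is_derive_eq; rewrite /GRing.scale/=; ring.
rewrite (@continuous_FTC2 _ _ (fun x : R => - (F x * pdf x))).
- by congr EFin; ring.
- by [].
- apply: continuous_subspaceT => x.
  by apply: cvgM; [exact: ch|exact: cpdf].
- have cFp : continuous (fun x : R => - (F x * pdf x)).
    by move=> x; apply: cvgN; apply: cvgM; [exact: cF|exact: cpdf].
  split.
  + by move=> x _; have [] := dFp x.
  + by apply: cvg_at_right_filter; exact: cFp.
  + by apply: cvg_at_left_filter; exact: cFp.
- by move=> x _; rewrite derive1E; have [_ ->] := dFp x.
Qed.

Lemma nondecreasing_set_itvNn :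
  {homo (fun n : nat => `[- n%:R, n%:R]%classic : set R) : n m / (n <= m)%N >-> (n <= m)%O}.
Proof.
move=> n m nm; apply/subsetPset => x /=; rewrite !in_itv/= => /andP[h1 h2].
have nmR : n%:R <= m%:R :> R by rewrite ler_nat.
by rewrite (le_trans _ h1) ?lerN2// (le_trans h2).
Qed.

Lemma bigcup_itvNn : \bigcup_n `[- n%:R, n%:R] = [set: R].
Proof.
apply/seteqP; split => // x _; exists (Num.bound `|x|) => //=.
by rewrite in_itv/= -ler_norml; apply/ltW/archi_boundP.
Qed.

Lemma integral_normal_sqr_itv_le1 (r : R) : 0 < r ->
  (\int[N]_(x in `[(- r)%R, r]) (x ^+ 2)%:E <= 1)%E.
Proof.
move=> r0; have rr : - r < r by rewrite gtrN.
have c1 : continuous (cst 1 : R -> R) by move=> x; exact: cvg_cst.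
have := @integral_itv_stein id (cst 1) (- r) r rr (fun x => is_derive_id _ _) c1.
have I2 := @integrable_normal_itv (fun x => x ^+ 2) (- r) r (@exprn_continuous _ 2).
have I1 := @integrable_normal_itv (cst 1) (- r) r c1.
rewrite /=; under eq_integral do rewrite -expr2 EFinB.
rewrite integralB//= integral_cst//= mul1e => E1.
(* the boundary term of the integration by parts is nonpositive *)
have : (\int[N]_(x in `[(- r)%R, r]) (x ^+ 2)%:E - N `[(- r)%R, r]%classic <= 0)%E.
  rewrite E1 lee_fin mulNr -opprD oppr_le0.
  by apply: addr_ge0; apply: mulr_ge0; rewrite ?normal_pdf_ge0 ?ltW.
rewrite sube_le0 => /le_trans; apply; exact: probability_le1.
Qed.

(** The second moments truncated to [-n, n] are all at most 1, so monotone convergence bounds the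
    full one. *)
Lemma integrable_normal_sqr : N.-integrable setT (fun x => (x ^+ 2)%:E).
Proof.
have mX : measurable_fun [set: R] (fun x : R => (x ^+ 2)%:E).
  by apply/measurable_EFinP; exact: measurable_funX.
apply/integrableP; split => //.
apply: (@le_lt_trans _ _ 1%E); last exact: ltry.
under eq_integral do rewrite gee0_abs ?lee_fin ?sqr_ge0//.
have := @ge0_nondecreasing_set_cvg_integral _ _ _ _ _ N
  nondecreasing_set_itvNn (fun=> measurable_itv _) (fun=> measurable_funTS mX).
rewrite bigcup_itvNn => h.
have {}h := h (fun _ x _ => sqr_ge0 x).
rewrite -(cvg_lim _ h)//.
apply: lime_le.
  apply: ereal_nondecreasing_is_cvgn => n m nm; apply: ge0_subset_integral => //=.
  - by apply: measurable_funTS.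
  - by move=> x _; rewrite lee_fin sqr_ge0.
  - by move/subsetPset : (nondecreasing_set_itvNn nm).
(* For n = 0 the interval is a point, which the bound for r > 0 does not cover; the integrand
   vanishes there. *)
apply: nearW => -[|n].
  rewrite (_ : `[_, _] = [set 0]); last by rewrite oppr0 set_itv1.
  rewrite [X in (X <= _)%E](_ : _ = 0%E) ?lee01//.
  by apply: integral0_eq => x -> ; rewrite expr0n.
by apply: integral_normal_sqr_itv_le1; rewrite ltr0n.
Qed.

(** One factor 1 + |x| comes from the growth of F and another from the denominator; their product is
    at most 4 (1 + x^2 / 2), which the quadratic decay of the density absorbs. *)
Lemma linear_growth_pdf_le (F : R -> R) (C x : R) :
  `|F x| <= C * (1 + `|x|) ->
  `|F x * pdf x| <= C * (4 * normal_peak 1) / (1 + `|x|).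
Proof.
move=> FC; have x0 : 0 < 1 + `|x| by rewrite ltr_wpDr.
rewrite ler_pdivlMr// normrM (ger0_norm (normal_pdf_ge0 _ _ _)).
have p0 := normal_pdf_ge0 0 1 x; have px := normal_pdf01_le x.
have C0 : 0 <= C by rewrite -(pmulr_lge0 _ x0) (le_trans _ FC).
have h : pdf x * (1 + `|x|) ^+ 2 <= 4 * normal_peak 1.
  apply: (le_trans (y := pdf x * (4 * (1 + x ^+ 2 / 2)))).
    apply: ler_wpM2l => //; rewrite -[x ^+ 2]real_normK ?num_real//; nra.
  by rewrite mulrCA ler_pM2l.
apply: le_trans (_ : C * (1 + `|x|) * pdf x * (1 + `|x|) <= _).
  by rewrite ler_wpM2r ?(ltW x0)// ler_wpM2r.
by rewrite -!mulrA ler_wpM2l// mulrCA -expr2.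
Qed.

Lemma integrable_normal_stein F G (C : R) :
  (forall x : R, is_derive x 1 F (G x)) -> continuous G ->
  (forall x, `|F x| <= C * (1 + `|x|)) -> (forall x, `|G x| <= C) ->
  N.-integrable setT (fun x => (x * F x - G x)%:E).
Proof.
move=> dF cG FC GC.
have C0 : 0 <= C by rewrite (le_trans _ (GC 0)).
have cF : continuous F.
  move=> x; apply: differentiable_continuous; apply/derivable1_diffP.
  by have [] := dF x.
apply: (@le_integrable _ _ R N setT measurableT _ (fun x => (C * 2 * (1 + x ^+ 2))%:E)).
- apply/measurable_EFinP; apply: measurable_funB.
    by apply: measurable_funM => //; exact: continuous_measurable_fun.
  exact: continuous_measurable_fun.
- move=> x _; rewrite !abse_EFin lee_fin [leRHS]ger0_norm; last first.
    by rewrite mulr_ge0 ?addr_ge0 ?sqr_ge0// mulr_ge0.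
  apply: (le_trans (ler_normB _ _)); rewrite normrM.
  have := FC x; have := GC x; have := normr_ge0 x.
  rewrite -[x ^+ 2]real_normK ?num_real//.
  move: `|x| `|F x| `|G x| => a f g a0 gC fC.
  have h : a * f <= a * (C * (1 + a)) by rewrite ler_wpM2l.
  have h2 : C * (2 * a) <= C * (1 + a ^+ 2) by rewrite ler_wpM2l//; have := sqr_ge0 (a - 1); nra.
  nra.
- rewrite (_ : (fun _ => _) = (fun x => (C * 2)%:E * ((cst 1 x)%:E + (x ^+ 2)%:E))%E)//.
  apply: integrableZl => //; apply: integrableD => //=.
    exact: finite_measure_integrable_cst.
  exact: integrable_normal_sqr.
Qed.

(** The integral over [-n, n] tends to the full integral by dominated convergence, and to 0 because
    it equals a boundary term of order 1/n. *)
Lemma integral_normal_stein F G (C : R) :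
  (forall x : R, is_derive x 1 F (G x)) -> continuous G ->
  (forall x, `|F x| <= C * (1 + `|x|)) -> (forall x, `|G x| <= C) ->
  (\int[N]_x (x * F x - G x)%:E = 0)%E.
Proof.
move=> dF cG FC GC.
have Ih := integrable_normal_stein dF cG FC GC.
set h := (fun x => (x * F x - G x)%:E) in Ih *.
(* The shift to [n.+1] keeps the endpoints distinct, as [integral_itv_stein] requires. *)
pose I (n : nat) : set R := `[- n.+1%:R, n.+1%:R]%classic.
have mI n : measurable (I n) by exact: measurable_itv.
have cvg1 : (\int[N]_(x in I n) h x)%E @[n --> \oo] --> (\int[N]_x h x)%E.
  rewrite (_ : (fun n => _) = (fun n => \int[N]_x (h \_ (I n)) x)%E); last first.
    by apply/funext => n; rewrite integral_mkcond.
  apply: (@dominated_cvg _ _ R N setT measurableT (fun n => h \_ (I n)) h (abse \o h)) => //.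
  - move=> n; apply/(measurable_restrictT _ (mI n)).
    by apply: measurable_funTS; exact: measurable_int Ih.
  - move=> x _; apply: cvg_near_cst; near=> n.
    rewrite patchE mem_set// /I /= in_itv/= -ler_norml.
    rewrite (@le_trans _ _ (Num.bound `|x|)%:R)//.
      by apply/ltW/archi_boundP.
    rewrite ler_nat; apply: leqW; near: n; exact: nbhs_infty_ge.
  - exact: integrable_abse.
  - by move=> n x _; rewrite patchE; case: ifP => //= _; rewrite normr0 lee_fin normr_ge0.
have cvg2 : (\int[N]_(x in I n) h x)%E @[n --> \oo] --> (0%E : \bar R).
  under eq_fun => n.
    rewrite (integral_itv_stein (F := F) (G := G)) ?gtrN//; over.
  apply: cvg_EFin; first exact: nearW.
  apply: norm_cvg0 => /=.
  (* The factor 2 accounts for the two endpoints. *)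
  pose K := 2 * (C * (4 * normal_peak 1)).
  apply: (@squeeze_cvgr _ _ _ _ (cst 0) (fun n => K * n.+1%:R^-1)).
  - apply: nearW => n; rewrite normr_ge0/=.
    have e m : `|m| = n.+1%:R -> `|F m * pdf m| <= C * (4 * normal_peak 1) / n.+1%:R.
      move=> mn; apply: le_trans (linear_growth_pdf_le (FC m)) _.
      have C0 : 0 <= C by rewrite (le_trans _ (GC 0)).
      rewrite mn ler_wpM2l ?mulr_ge0 ?normal_peak_ge0//.
      by rewrite lef_pV2 ?posrE ?addr_gt0// lerDr.
    rewrite /K -mulrA mulr_natl mulr2n.
    apply: (le_trans (ler_normB _ _)); apply: lerD; apply: e.
      by rewrite normrN ger0_norm.
    by rewrite ger0_norm.
  - exact: cvg_cst.
  - rewrite -[X in _ --> X](mulr0 K); apply: cvgM; first exact: cvg_cst.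
    exact: cvg_harmonic.
exact: (cvg_unique _ cvg1 cvg2).
Unshelve. all: by end_near.
Qed.

End OneDimensionalGaussian.

(** * Second moments and Stein's identity for the standard normal vector *)

Section StandardNormalVector.
Context {R : realType}.
Local Notation N := (@normal_prob R 0 1).

(** Write (c + b a)^2 = b^2 (a a - 1) + 2 b c a + (c^2 + b^2). The first two terms are multiples of
    Stein integrands, for F = id and F = 1, and integrate to 0. *)
Lemma integral_normal_affine_sqr (b c : R) :
  (\int[N]_a ((c + b * a) ^+ 2)%:E = (c ^+ 2 + b ^+ 2)%:E)%E.
Proof.
have dcst (x : R) : is_derive x 1 (cst 1 : R -> R) 0 by exact: is_derive_cst.
have did (x : R) : is_derive x 1 (id : R -> R) 1 by exact: is_derive_id.
have ccst (k : R) : continuous (cst k : R -> R) by move=> x; exact: cvg_cst.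
have b1 (x : R) : `|cst 1 x : R| <= 1 * (1 + `|x|) by rewrite mul1r normr1 lerDl.
have b2 (x : R) : `|id x| <= 1 * (1 + `|x|) by rewrite mul1r lerDr.
have b0 (x : R) : `|cst 0 x : R| <= 1 by rewrite normr0.
have b3 (x : R) : `|cst 1 x : R| <= 1 by rewrite normr1.
have I1 := integrable_normal_stein dcst (ccst 0) b1 b0.
have I2 := integrable_normal_stein did (ccst 1) b2 b3.
have E1 := integral_normal_stein dcst (ccst 0) b1 b0.
have E2 := integral_normal_stein did (ccst 1) b2 b3.
rewrite (_ : (fun a => _) = (fun a : R =>
   ((b ^+ 2)%:E * (a * id a - 1)%:E + (c * b * 2)%:E * (a * 1 - 0)%:E)
    + (cst (c ^+ 2 + b ^+ 2) a)%:E)%E); last first.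
  by apply/funext => a; rewrite -!EFinM -!EFinD /=; congr EFin; ring.
rewrite integralD//=; last 2 first.
- by apply: integrableD => //; apply: integrableZl.
- exact: finite_measure_integrable_cst.
rewrite integralD//=; [|exact: integrableZl..].
rewrite !integralZl//= E1 E2 !mule0 !add0e integral_cst//=.
by rewrite probability_setT mule1.
Qed.

Lemma measurable_entry n (i : 'I_n) :
  measurable_fun setT (fun z : 'cV[R]_n => z i 0).
Proof. by have /measurable_cVP := @measurable_id _ 'cV[R]_n setT; exact. Qed.

Lemma ge0_integral_std_normalS n (f : 'cV[R]_n.+1 -> \bar R) :
  measurable_fun setT f -> (forall z, 0 <= f z)%E ->
  (\int[std_normal n.+1]_z f z =
   \int[N]_a \int[std_normal n]_x f (consV (a, x)))%E.
Proof.
move=> mf f0; rewrite [LHS]ge0_integral_distribution// fubini_tonelli1//.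
  exact: measurableT_comp.
by move=> x; exact: f0.
Qed.

(** Both orders of integration are given so that the coordinate carrying Stein's identity can always
    be placed in the inner integral. *)
Lemma integral_std_normalS n (f : 'cV[R]_n.+1 -> \bar R) :
  (std_normal n.+1).-integrable setT f ->
  ((\int[std_normal n.+1]_z f z =
   \int[N]_a \int[std_normal n]_x f (consV (a, x))) /\
   (\int[std_normal n.+1]_z f z =
   \int[std_normal n]_x \int[N]_a f (consV (a, x))))%E.
Proof.
move=> If; have mf := measurable_int _ If.
have Ic : (N \x std_normal n)%E.-integrable setT (f \o @consV R n).
  apply/integrableP; split; first exact: measurableT_comp.
  move/integrableP : If => [_].
  by rewrite [X in (X < _)%E -> _]ge0_integral_distribution//; exact: measurableT_comp.
split; rewrite [LHS]integral_distribution//.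
- by rewrite -integral12_prod_meas1.
- by rewrite -integral21_prod_meas1.
Qed.

Lemma measurable_affine_form n (b : 'I_n -> R) (c : R) :
  measurable_fun setT (fun z : 'cV[R]_n => c + \sum_i b i * z i 0).
Proof.
apply: measurable_funD => //; apply: measurable_sum => i.
by apply: measurable_funM => //; exact: measurable_entry.
Qed.

(** Induction on the dimension: once the first coordinate a is fixed, the form is affine in the
    others with constant term c + b_0 a. *)
Lemma integral_std_normal_affine_sqr n (b : 'I_n -> R) (c : R) :
  (\int[std_normal n]_z ((c + \sum_i b i * z i 0) ^+ 2)%:E =
   (c ^+ 2 + \sum_i b i ^+ 2)%:E)%E.
Proof.
elim: n b c => [|n IH] b c.
  rewrite /= integral_dirac//=; last first.
    by apply/measurable_EFinP/measurable_funX; exact: measurable_affine_form.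
  by rewrite diracT mul1e !big_ord0 !addr0.
rewrite ge0_integral_std_normalS; last 2 first.
- by apply/measurable_EFinP/measurable_funX; exact: measurable_affine_form.
- by move=> z; rewrite lee_fin sqr_ge0.
transitivity (\int[N]_a (((c + b ord0 * a) ^+ 2)%:E +
    (cst (\sum_(i < n) b (lift ord0 i) ^+ 2) a)%:E))%E.
  apply: eq_integral => a _; rewrite -EFinD -IH; apply: eq_integral => x _.
  rewrite big_ord_recl addrA mxE unlift_none; congr (EFin ((_ + _) ^+ 2)).
  by apply: eq_bigr => i _; rewrite mxE liftK.
rewrite ge0_integralD//=; last 3 first.
- by move=> x _; rewrite lee_fin sqr_ge0.
- by apply/measurable_EFinP/measurable_funX/measurable_funD => //; exact: measurable_funM.
- by move=> x _; rewrite lee_fin sumr_ge0// => i _; rewrite sqr_ge0.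
rewrite integral_normal_affine_sqr integral_cst//= probability_setT mule1.
by rewrite -EFinD big_ord_recl addrA.
Qed.

Lemma integrable_std_normal_affine_sqr n (b : 'I_n -> R) (c : R) :
  (std_normal n).-integrable setT
    (fun z : 'cV[R]_n => ((c + \sum_i b i * z i 0) ^+ 2)%:E).
Proof.
apply/integrableP; split.
  by apply/measurable_EFinP/measurable_funX; exact: measurable_affine_form.
under eq_integral do rewrite gee0_abs ?lee_fin ?sqr_ge0//.
by rewrite integral_std_normal_affine_sqr ltry.
Qed.

Lemma integrable_std_normal_stein n (j : 'I_n) (f g : 'cV[R]_n -> R) (C : R) :
  measurable_fun setT f -> measurable_fun setT g ->
  (forall z, `|f z| <= C) -> (forall z, `|g z| <= C) ->
  (std_normal n).-integrable setT (fun z => (z j 0 * f z - g z)%:E).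
Proof.
move=> mf mg fC gC; have C0 : 0 <= C by rewrite (le_trans _ (fC 0)).
apply: (@le_integrable _ _ R (std_normal n) setT measurableT _
  (* The dominating function is 2 C + C z_j^2, with z_j written as an affine form so that
     [integrable_std_normal_affine_sqr] applies. *)
  (fun z => (C%:E * (cst 2 z)%:E + C%:E * ((0 + \sum_i (i == j)%:R * z i 0) ^+ 2)%:E)%E)).
- apply/measurable_EFinP; apply: measurable_funB => //.
  by apply: measurable_funM => //; exact: measurable_entry.
- move=> z _; rewrite -!EFinM -EFinD !abse_EFin lee_fin [leRHS]ger0_norm; last first.
    by apply: addr_ge0; apply: mulr_ge0; rewrite ?sqr_ge0.
  rewrite add0r (bigD1 j)//= eqxx mul1r big1 ?addr0; last first.
    by move=> i /negPf ->; rewrite mul0r.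
  apply: (le_trans (ler_normB _ _)); rewrite normrM.
  have := fC z; have := gC z; have := normr_ge0 (z j 0).
  rewrite -[z j 0 ^+ 2]real_normK ?num_real//.
  move: `|z j 0| `|f z| `|g z| => a x y a0 yC xC.
  have h : a * x <= a * C by rewrite ler_wpM2l.
  have h2 : C * a <= C * (1 + a ^+ 2).
    by rewrite ler_wpM2l//; have := sqr_ge0 (a - 1); nra.
  nra.
- apply: integrableD => //; apply: integrableZl => //.
    exact: finite_measure_integrable_cst.
  exact: integrable_std_normal_affine_sqr.
Qed.

(** Induction on the dimension. By Fubini it suffices that an inner integral vanish identically:
    over the tail, by induction, when j is not the first coordinate, and over the first coordinate,
    by the one-dimensional identity, when it is. *)
Lemma integral_std_normal_stein n (j : 'I_n) (f g : 'cV[R]_n -> R) (C : R) :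
  measurable_fun setT f -> measurable_fun setT g ->
  (forall z, `|f z| <= C) -> (forall z, `|g z| <= C) ->
  (forall z (t : R), is_derive t 1 (fun s : R => f (z + s *: delta_mx j 0))
    (g (z + t *: delta_mx j 0))) ->
  (forall z, continuous (fun s : R => g (z + s *: delta_mx j 0))) ->
  (\int[std_normal n]_z (z j 0 * f z - g z)%:E = 0)%E.
Proof.
elim: n j f g => [[]//|n IH] j f g mf mg fC gC df cg.
have If := integrable_std_normal_stein j mf mg fC gC.
have C0 : 0 <= C by rewrite (le_trans _ (fC 0)).
have mcons (h : 'cV[R]_n.+1 -> R) : measurable_fun setT h ->
    measurable_fun setT (h \o @consV R n) by move=> mh; exact: measurableT_comp.
case: (unliftP ord0 j) => [k|] jE; rewrite jE in df cg If *.
- rewrite (integral_std_normalS If).1; apply: integral0_eq => a _.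
  (* Moving the tail along its k-th axis moves the whole vector along axis [lift ord0 k], so the
     hypotheses on f and g pass to the slice at a. *)
  have shift x (s : R) :
      consV (a, x + s *: delta_mx k 0) = consV (a, x) + s *: delta_mx (lift ord0 k) 0.
    apply/colP => i; rewrite !mxE; case: unliftP => [l ->|->].
      by rewrite !mxE (inj_eq lift_inj).
    by rewrite (negPf (neq_lift _ _)) mulr0 addr0.
  under eq_integral do rewrite mxE liftK /=.
  apply: (IH k (fun x => f (consV (a, x))) (fun x => g (consV (a, x)))) => //.
  + exact: (measurable_fun_pair2 a (mcons _ mf)).
  + exact: (measurable_fun_pair2 a (mcons _ mg)).
  + by move=> x t; under eq_fun do rewrite shift; rewrite shift; exact: df.
  + by move=> x; under eq_fun do rewrite shift; exact: cg.
- rewrite (integral_std_normalS If).2; apply: integral0_eq => x _.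
  have shift (s : R) : consV (s, x) = consV (0, x) + s *: delta_mx ord0 0.
    apply/colP => i; rewrite !mxE; case: unliftP => [l ->|->].
      by rewrite eq_sym (negPf (neq_lift _ _)) mulr0 addr0.
    by rewrite eqxx mulr1 add0r.
  under eq_integral do rewrite mxE unlift_none /=.
  apply: (@integral_normal_stein _ (fun a => f (consV (a, x))) (fun a => g (consV (a, x))) C).
  + by move=> t; under eq_fun do rewrite shift; rewrite shift; exact: df.
  + by under eq_fun do rewrite shift; exact: cg.
  (* A bounded f satisfies the linear growth condition a fortiori. *)
  + by move=> t; rewrite (le_trans (fC _))// ler_peMr// lerDl.
  + by move=> t; exact: gC.
Qed.

End StandardNormalVector.

(** * Inner products and Stein's identity for the field A^T v / (|v|^2 + e) *)

Section SteinField.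
Context {R : realType}.

Definition dotV n (x y : 'cV[R]_n) : R := (x^T *m y) 0 0.

Lemma dotVE n (x y : 'cV[R]_n) : dotV x y = \sum_i x i 0 * y i 0.
Proof. by rewrite /dotV mxE; apply: eq_bigr => i _; rewrite mxE. Qed.

Lemma dotVC n (x y : 'cV[R]_n) : dotV x y = dotV y x.
Proof. by rewrite !dotVE; apply: eq_bigr => i _; rewrite mulrC. Qed.

Lemma dotVDr n (x y z : 'cV[R]_n) : dotV x (y + z) = dotV x y + dotV x z.
Proof. by rewrite /dotV mulmxDr mxE. Qed.

Lemma dotVZr n a (x y : 'cV[R]_n) : dotV x (a *: y) = a * dotV x y.
Proof. by rewrite /dotV -scalemxAr mxE. Qed.

Lemma dotVDl n (x y z : 'cV[R]_n) : dotV (x + y) z = dotV x z + dotV y z.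
Proof. by rewrite ![dotV _ z]dotVC dotVDr. Qed.

Lemma dotVZl n a (x y : 'cV[R]_n) : dotV (a *: x) y = a * dotV x y.
Proof. by rewrite ![dotV _ y]dotVC dotVZr. Qed.

Lemma dotV_mulmxl m n (A : 'M[R]_(m, n)) (x : 'cV[R]_n) (y : 'cV[R]_m) :
  dotV (A *m x) y = dotV x (A^T *m y).
Proof. by rewrite /dotV trmx_mul mulmxA. Qed.

Lemma dotV_ge0 n (x : 'cV[R]_n) : 0 <= dotV x x.
Proof. by rewrite dotVE sumr_ge0// => i _; rewrite -expr2 sqr_ge0. Qed.

Lemma dotV_eq0 n (x : 'cV[R]_n) : (dotV x x == 0) = (x == 0).
Proof.
apply/idP/eqP => [|->]; last by rewrite /dotV mulmx0 mxE.
rewrite dotVE psumr_eq0 => [/allP x0|i _]; last by rewrite -expr2 sqr_ge0.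
apply/colP => i; rewrite mxE; apply/eqP.
by have := x0 i (mem_index_enum i); rewrite mulf_eq0 orbb.
Qed.

Lemma l2norm_dotV n (x : 'cV[R]_n) : l2norm x ^+ 2 = dotV x x.
Proof. by rewrite l2normK dotVE; apply: eq_bigr => i _; rewrite expr2. Qed.

Lemma dotVDD n (x y : 'cV[R]_n) a :
  dotV (x + a *: y) (x + a *: y) = dotV x x + 2 * a * dotV y x + a ^+ 2 * dotV y y.
Proof.
by rewrite !(dotVDl, dotVDr, dotVZl, dotVZr) [dotV x y]dotVC; ring.
Qed.

(** Both |y + x|^2 and |y - x|^2 are nonnegative. This serves as a Cauchy-Schwarz bound in additive
    form. *)
Lemma normr_dotV_le n (x y : 'cV[R]_n) : 2 * `|dotV x y| <= dotV x x + dotV y y.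
Proof.
have := dotV_ge0 (y + 1 *: x); have := dotV_ge0 (y + (-1) *: x).
by rewrite !dotVDD; case: (ger0P (dotV x y)) => _; lra.
Qed.

Lemma dotV_col m n (A : 'M[R]_(m, n)) (x : 'cV[R]_m) j :
  dotV (col j A) x = (A^T *m x) j 0.
Proof. by rewrite dotVE mxE; apply: eq_bigr => i _; rewrite !mxE. Qed.

(** This identity and the next two collapse the sum over coordinates of Stein's terms into
    quantities that depend on A only through A z and A A^T. *)
Lemma sum_dotV_col m n (A : 'M[R]_(m, n)) (x : 'cV[R]_m) (z : 'cV[R]_n) :
  \sum_j z j 0 * dotV (col j A) x = dotV (A *m z) x.
Proof. by rewrite dotV_mulmxl dotVE; apply: eq_bigr => j _; rewrite dotV_col. Qed.

Lemma sum_dotV_col_sqr m n (A : 'M[R]_(m, n)) (x : 'cV[R]_m) :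
  \sum_j dotV (col j A) x ^+ 2 = dotV x (A *m A^T *m x).
Proof.
rewrite -mulmxA [RHS]dotVC dotV_mulmxl dotVE.
by apply: eq_bigr => j _; rewrite dotV_col expr2.
Qed.

Lemma sum_dotV_col_col m n (A : 'M[R]_(m, n)) :
  \sum_j dotV (col j A) (col j A) = \tr (A *m A^T).
Proof.
rewrite mxtrace_mulC /mxtrace; apply: eq_bigr => j _.
by rewrite dotVE mxE; apply: eq_bigr => i _; rewrite !mxE.
Qed.

Lemma measurable_dotV d (T : measurableType d) n (f g : T -> 'cV[R]_n) :
  measurable_fun setT f -> measurable_fun setT g ->
  measurable_fun setT (fun t => dotV (f t) (g t)).
Proof.
move=> /measurable_cVP mf /measurable_cVP mg.
under eq_fun do rewrite dotVE.
by apply: measurable_sum => i; exact: measurable_funM.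
Qed.

(** With a = col j A, L = <a, v>, m = |a|^2 and q standing for |v|^2 + e, the quotient is coordinate
    j of the field A^T v / (|v|^2 + e) along the line v + s a. *)
Lemma is_derive_stein_line (L m q t : R) :
  0 < q + 2 * t * L + t ^+ 2 * m ->
  is_derive t 1 (fun s : R => (L + s * m) / (q + 2 * s * L + s ^+ 2 * m))
   (m / (q + 2 * t * L + t ^+ 2 * m) -
    2 * ((L + t * m) / (q + 2 * t * L + t ^+ 2 * m)) ^+ 2).
Proof.
set N := (fun s : R => L + s * m).
set D := (fun s : R => q + 2 * s * L + s ^+ 2 * m) => Dt.
have dN : is_derive t 1 N m.
  have -> : N = cst L + m \*: id by apply/funext => s; rewrite /N mulrC.
  apply: is_derive_eq; rewrite add0r; exact: mulr1.
have dD : is_derive t 1 D (2 * (L + t * m)).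
  have -> : D = cst q + (2 * L) \*: id + m \*: (id ^+ 2).
    by apply/funext => s; rewrite /D /=; congr (_ + _ + _); rewrite mulrC// mulrA [_ * 2]mulrC.
  apply: is_derive_eq; rewrite add0r.
  have E : 2 * L * 1 + m * (2 * t ^+ 1 * 1) = 2 * (L + t * m) by ring.
  exact: E.
have D0 : D t != 0 by rewrite gt_eqF.
have dV := is_deriveV D0 dD.
apply: is_derive_eq.
have E : N t * (- (D t ^+ 2)^-1 * (2 * (L + t * m))) + (D t)^-1 * m =
    m / D t - 2 * (N t / D t) ^+ 2.
  by rewrite -/(N t); field.
exact: E.
Qed.

Lemma continuous_stein_line (L m q : R) :
  (forall s, 0 < q + 2 * s * L + s ^+ 2 * m) ->
  continuous (fun s : R => m / (q + 2 * s * L + s ^+ 2 * m) -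
    2 * ((L + s * m) / (q + 2 * s * L + s ^+ 2 * m)) ^+ 2).
Proof.
move=> D0 t.
have cD : (fun s : R => q + 2 * s * L + s ^+ 2 * m) @ t --> q + 2 * t * L + t ^+ 2 * m.
  apply: cvgD; first apply: cvgD; first exact: cvg_cst.
    by apply: cvgM; [apply: cvgM; [exact: cvg_cst|exact: cvg_id]|exact: cvg_cst].
  by apply: cvgM; [exact: exprn_continuous|exact: cvg_cst].
have cN : (fun s : R => L + s * m) @ t --> L + t * m.
  by apply: cvgD; [exact: cvg_cst|apply: cvgM; [exact: cvg_id|exact: cvg_cst]].
have cV : (fun s : R => (q + 2 * s * L + s ^+ 2 * m)^-1) @ t -->
    (q + 2 * t * L + t ^+ 2 * m)^-1 by apply: cvgV cD; rewrite gt_eqF.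
apply: cvgB; first by apply: cvgM; [exact: cvg_cst|exact: cV].
apply: cvgM; first exact: cvg_cst.
have cNV : (fun s : R => (L + s * m) / (q + 2 * s * L + s ^+ 2 * m)) @ t -->
    (L + t * m) / (q + 2 * t * L + t ^+ 2 * m) by apply: cvgM; [exact: cN|exact: cV].
by apply: cvgM; exact: cNV.
Qed.

(** Each coordinate of W z is a linear form whose second moment is the squared norm of a row of W;
    these sum to the trace. *)
Lemma integral_dotV_mulmx m n (W : 'M[R]_(m, n)) :
  (\int[std_normal n]_z (dotV (W *m z) (W *m z))%:E = (\tr (W *m W^T))%:E)%E.
Proof.
transitivity (\int[std_normal n]_z
    \sum_(k < m) ((0 + \sum_j W k j * z j 0) ^+ 2)%:E)%E.
  apply: eq_integral => z _; rewrite dotVE sumEFin; congr EFin.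
  by apply: eq_bigr => k _; rewrite add0r !mxE expr2.
rewrite ge0_integral_sum//=; last 2 first.
- by move=> k; apply/measurable_EFinP/measurable_funX; exact: measurable_affine_form.
- by move=> k z _; rewrite lee_fin sqr_ge0.
under eq_bigr do rewrite integral_std_normal_affine_sqr.
rewrite sumEFin /mxtrace; congr EFin; apply: eq_bigr => k _.
by rewrite expr0n add0r mxE; apply: eq_bigr => j _; rewrite mxE expr2.
Qed.

Lemma integral_std_normal_stein_field m n (A : 'M[R]_(m, n)) (u : 'cV[R]_m)
    (e : R) (j : 'I_n) :
  let v z := u + A *m z in
  let q z := dotV (v z) (v z) in
  let L z := dotV (col j A) (v z) in
  let h (z : 'cV[R]_n) := z j 0 * (L z / (q z + e)) -
    (dotV (col j A) (col j A) / (q z + e) - 2 * (L z / (q z + e)) ^+ 2) in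
  0 < e ->
  (std_normal n).-integrable setT (EFin \o h) /\
  (\int[std_normal n]_z (h z)%:E = 0)%E.
Proof.
move=> v q L h e0; set mj := dotV (col j A) (col j A).
have m0 : 0 <= mj := dotV_ge0 _.
have mv : measurable_fun setT v.
  by apply: measurable_cV_add => //; exact: measurable_cV_mulmx.
have mq : measurable_fun setT q by exact: measurable_dotV.
have mL : measurable_fun setT L by exact: measurable_dotV.
have q0 z : 0 < q z + e by rewrite ltr_wpDl// dotV_ge0.
have mV : measurable_fun setT (fun z => (q z + e)^-1).
  under eq_fun do rewrite -powR_inv1 ?ltW//.
  by apply: (measurableT_comp (measurable_powR _)); exact: measurable_funD.
have mf : measurable_fun setT (fun z => L z / (q z + e)) by exact: measurable_funM.
(* From 2 |L| <= mj + q one gets |L| <= mj + q, and this is at most (mj / e + 1) (q + e). *)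
pose K := mj / e + 1.
have K0 : 0 <= mj / e by rewrite divr_ge0// ltW.
have fK z : `|L z / (q z + e)| <= K.
  rewrite normrM normfV (gtr0_norm (q0 z)) ler_pdivrMr// /K.
  have := normr_dotV_le (col j A) (v z); rewrite -/mj -/(q z) -/(L z) => h1.
  have qz : 0 <= q z by exact: dotV_ge0.
  have e1 : mj / e * e = mj by rewrite divfK// gt_eqF.
  have h2 : 0 <= mj / e * q z by exact: mulr_ge0.
  nra.
have gK z : `|mj / (q z + e) - 2 * (L z / (q z + e)) ^+ 2| <= mj / e + 2 * K ^+ 2.
  apply: (le_trans (ler_normB _ _)); apply: lerD.
    rewrite ger0_norm ?divr_ge0 ?(ltW (q0 z))// ler_wpM2l// lef_pV2 ?posrE// lerDr.
    exact: dotV_ge0.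
  rewrite normrM (ger0_norm (ler0n _ _)) ler_pM2l// normrX.
  by rewrite lerXn2r ?nnegrE ?normr_ge0// (le_trans (normr_ge0 _) (fK z)).
(* Stein's identity takes one common bound for the field and its derivative; K >= 1 makes the
   derivative's bound serve for both. *)
have fK' z : `|L z / (q z + e)| <= mj / e + 2 * K ^+ 2.
  apply: le_trans (fK z) _; rewrite /K; nra.
have mg : measurable_fun setT (fun z => mj / (q z + e) - 2 * (L z / (q z + e)) ^+ 2).
  apply: measurable_funB; first exact: measurable_funM.
  by apply: measurable_funM => //; exact: measurable_funX.
split; first exact: integrable_std_normal_stein mf mg fK' gK.
have vs z (s : R) : v (z + s *: delta_mx j 0) = v z + s *: col j A.
  by rewrite /v mulmxDr addrA -scalemxAr -colE.
have qs z (s : R) : q (z + s *: delta_mx j 0) + e = (q z + e) + 2 * s * L z + s ^+ 2 * mj.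
  by rewrite /q vs dotVDD -/(L z) -/mj; ring.
have Ls z (s : R) : L (z + s *: delta_mx j 0) = L z + s * mj.
  by rewrite /L vs dotVDr dotVZr.
apply: integral_std_normal_stein mf mg fK' gK _ _ => [z t|z].
  under eq_fun do rewrite Ls qs; rewrite Ls qs.
  by apply: is_derive_stein_line; rewrite -qs.
under eq_fun do rewrite Ls qs.
by apply: continuous_stein_line => s; rewrite -qs.
Qed.

End SteinField.

(** * The risk of shrinkage towards the mean *)

Section JamesStein.
Context {R : realType}.

(** The orthogonal projection onto the complement of the all-ones vector; here [const_mx 1] is the
    square all-ones matrix. *)
Definition centering_mx d : 'M[R]_d := 1%:M - d%:R^-1 *: const_mx 1.

Lemma centerVE d (y : 'cV[R]_d) : centerV y = centering_mx d *m y.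
Proof.
rewrite /centerV /centering_mx mulmxBl mul1mx -scalemxAl; congr (_ - _).
apply/colP => i; rewrite !mxE mulr1 /meanV; congr (_ * _).
by apply: eq_bigr => j _; rewrite mxE mul1r.
Qed.

Lemma tr_centering_mx d : (centering_mx d)^T = centering_mx d.
Proof. by rewrite /centering_mx linearB linearZ /= trmx1 trmx_const. Qed.

Lemma centering_mx_idem d : (0 < d)%N ->
  centering_mx d *m centering_mx d = centering_mx d.
Proof.
move=> d0; rewrite {1}/centering_mx mulmxBl mul1mx -[RHS]subr0; congr (_ - _).
rewrite /centering_mx -scalemxAl mulmxBr mulmx1 -scalemxAr.
rewrite (_ : const_mx 1 *m const_mx 1 = d%:R *: const_mx 1).
  by rewrite scalerA mulVf ?pnatr_eq0 -?lt0n// scale1r subrr scaler0.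
apply/matrixP => i j; rewrite !mxE mulr1.
rewrite (eq_bigr (fun=> 1)) => [|k _]; last by rewrite !mxE mulr1.
by rewrite sumr_const card_ord.
Qed.

Lemma mxtrace_centering_mx d : (0 < d)%N -> \tr (centering_mx d) = d%:R - 1.
Proof.
move=> d0; rewrite /centering_mx linearB linearZ /= mxtrace1; congr (_ - _).
rewrite /mxtrace (eq_bigr (fun=> 1)) => [|k _]; last by rewrite mxE.
by rewrite sumr_const card_ord mulVf// pnatr_eq0 -lt0n.
Qed.

Lemma m_aE d (sigma : R) (y : 'cV[R]_d) :
  m_a sigma y = y + (- ((d%:R - 3) * sigma ^+ 2 / dotV (centerV y) (centerV y))) *: centerV y.
Proof.
rewrite /m_a l2norm_dotV scalerBl scale1r addrA scaleNr; congr (_ - _).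
by rewrite /centerV addrC subrK.
Qed.

(** If the integral were 0, f would vanish almost everywhere; as f vanishes nowhere, the whole space
    would be null, against its probability 1. *)
Lemma integral_gt0 d (T : measurableType d) (P : probability T R) (f : T -> R) :
  measurable_fun setT f -> (forall t, 0 < f t) ->
  (0 < \int[P]_t (f t)%:E)%E.
Proof.
move=> mf f0; rewrite lt_neqAle integral_ge0 ?andbT; last first.
  by move=> t _; rewrite lee_fin ltW.
apply/eqP => /esym I0.
have /(ae_eq_integral_abs P measurableT) : measurable_fun setT (EFin \o f).
  exact/measurable_EFinP.
under eq_integral do rewrite /= gtr0_norm//.
move=> [/(_ I0) [A [mA PA0 sub]] _].
have AT : A = setT.
  apply/seteqP; split => // t _; apply: sub => /= /(_ I)[] ft0.
  by have := f0 t; rewrite ft0 ltxx.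
by move: (probability_setT P); rewrite -AT [LHS]PA0 => /eqP; rewrite eq_sym onee_eq0.
Qed.

Section Risk.
Variables (n d : nat) (W : 'M[R]_(d, n)) (x : 'cV[R]_d) (sigma : R).
Hypotheses (d4 : (4 <= d)%N) (sigma0 : 0 < sigma)
  (WW : W *m W^T = (sigma ^+ 2)%:M).

Let A := centering_mx d *m W.
Let v (z : 'cV[R]_n) := centering_mx d *m x + A *m z.
Let q z := dotV (v z) (v z).
Let c : R := d%:R - 3.
Let s : R := sigma ^+ 2.

Let d0 : (0 < d)%N. Proof. by apply: leq_trans d4. Qed.
Let c0 : 0 < c.
Proof. by rewrite /c subr_gt0 ltr_nat. Qed.
Let s0 : 0 < s. Proof. exact: exprn_gt0. Qed.

Let vE z : v z = centerV (x + W *m z).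
Proof. by rewrite centerVE mulmxDr mulmxA. Qed.

Let AA : A *m A^T = s *: centering_mx d.
Proof.
rewrite /A trmx_mul mulmxA -(mulmxA _ W) WW -mulmxA mul_scalar_mx tr_centering_mx.
by rewrite -scalemxAr centering_mx_idem.
Qed.

Let Pv z : centering_mx d *m v z = v z.
Proof. by rewrite vE centerVE mulmxA centering_mx_idem. Qed.

(** Centering is self-adjoint and fixes v, so only the centered noise A z is seen by v. *)
Let dotWv z : dotV (W *m z) (v z) = dotV (A *m z) (v z).
Proof. by rewrite /A -mulmxA [RHS]dotV_mulmxl tr_centering_mx Pv. Qed.

(* The loss with 1/q replaced by 1/(q + e); F 0 is the loss of m_a itself, also
   where q = 0, since v vanishes there. *)
Let F e z := let w := W *m z + (- (c * s / (q z + e))) *: v z in dotV w w.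

Let FE e z : F e z = dotV (W *m z) (W *m z) +
  2 * (- (c * s / (q z + e))) * dotV (A *m z) (v z) + (c * s / (q z + e)) ^+ 2 * q z.
Proof. by rewrite /F dotVDD sqrrN [dotV (v z) (W *m z)]dotVC dotWv. Qed.

(* Stein's integrand for coordinate j and the field A^T v / (q + e). *)
Let h e j z := let L := dotV (col j A) (v z) in z j 0 * (L / (q z + e)) -
    (dotV (col j A) (col j A) / (q z + e) - 2 * (L / (q z + e)) ^+ 2).

Let q_ge0 z : 0 <= q z. Proof. exact: dotV_ge0. Qed.

(** Since A A^T is s times a projection of rank d - 1 that fixes v, the divergence terms become s (d
    - 1) and s q. *)
Let sum_h e z : \sum_j h e j z = dotV (A *m z) (v z) / (q z + e) -
  (s * (d%:R - 1) / (q z + e) - 2 * (s * q z / (q z + e) ^+ 2)).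
Proof.
rewrite /h sumrB; congr (_ - _).
  under eq_bigr do rewrite mulrA.
  by rewrite -mulr_suml sum_dotV_col.
rewrite sumrB; congr (_ - _).
  by rewrite -mulr_suml sum_dotV_col_col AA linearZ /= mxtrace_centering_mx.
rewrite -mulr_sumr; congr (_ * _).
under eq_bigr do rewrite expr_div_n.
rewrite -mulr_suml sum_dotV_col_sqr AA -scalemxAl Pv dotVZr; congr (_ / _).
Qed.

(** Subtracting 2 c s times the Stein sum, which has mean zero, cancels the cross term of the loss.
    Weakening 1/(q + e) to 1/(q + 1), by e <= 1, makes the gain independent of e. *)
Let F_le (e : R) z : 0 < e -> e <= 1 ->
  F e z <= dotV (W *m z) (W *m z) + (- (2 * c * s)) * (\sum_j h e j z) -
    (c * s) ^+ 2 / (q z + 1).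
Proof.
move=> e0 e1; have qz := q_ge0 z.
have qe : 0 < q z + e by rewrite ltr_wpDl.
have q1 : 0 < q z + 1 by rewrite ltr_wpDl.
rewrite FE sum_h.
have inv_le : (q z + 1)^-1 <= (q z + e)^-1 by rewrite lef_pV2 ?posrE// lerD2l.
have i0 : 0 < (q z + e)^-1 by rewrite invr_gt0.
have qi : q z * (q z + e)^-1 <= 1 by rewrite ler_pdivrMr// mul1r lerDl ltW.
have dE : d%:R = c + 3 by rewrite /c subrK.
rewrite dE -!exprVn !expr_div_n -!exprVn.
move: inv_le i0 qi; set i := (q z + e)^-1; set k := (q z + 1)^-1 => inv_le i0 qi.
set D := dotV _ _; set E := dotV _ _.
have h1 : q z * i ^+ 2 <= i by rewrite expr2 mulrA ler_piMl// ltW.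
rewrite -subr_ge0.
(* With i = 1/(q + e) and k = 1/(q + 1), the slack splits into two products of nonnegative factors,
   because k <= i and q i^2 <= i. The constant c + 3 - 1 is the rank d - 1. *)
have -> : D + - (2 * c * s) * (E * i - (s * (c + 3 - 1) * i - 2 * (s * q z * i ^+ 2)))
    - (c * s) ^+ 2 * k - (D + 2 * - (c * s * i) * E + (c * s) ^+ 2 * i ^+ 2 * q z)
  = (c * s) ^+ 2 * (i - k) + (4 * c * s ^+ 2 + (c * s) ^+ 2) * (i - q z * i ^+ 2).
  ring.
rewrite addr_ge0// mulr_ge0 ?subr_ge0// ?sqr_ge0//.
by rewrite addr_ge0 ?sqr_ge0// mulr_ge0 ?sqr_ge0// mulr_ge0// ltW.
Qed.

Let mv : measurable_fun setT v.
Proof. by apply: measurable_cV_add => //; exact: measurable_cV_mulmx. Qed.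

Let mq : measurable_fun setT q.
Proof. exact: measurable_dotV. Qed.

Let mqV (e : R) : 0 <= e -> measurable_fun setT (fun z => (q z + e)^-1).
Proof.
move=> e0.
under eq_fun do rewrite -powR_inv1 ?addr_ge0//.
by apply: (measurableT_comp (measurable_powR _)); exact: measurable_funD.
Qed.

Let mF (e : R) : 0 <= e -> measurable_fun setT (F e).
Proof.
move=> e0; apply: measurable_dotV; apply: measurable_cV_add;
  do ?exact: measurable_cV_mulmx.
all: apply: measurable_cV_scale => //; apply: measurable_funN.
all: apply: measurable_funM => //; exact: mqV.
Qed.

Let integral_F_le (e : R) : 0 < e -> e <= 1 ->
  (\int[std_normal n]_z (F e z)%:E <=
   (d%:R * s)%:E - ((c * s) ^+ 2)%:E * \int[std_normal n]_z ((q z + 1)^-1)%:E)%E.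
Proof.
move=> e0 e1.
have I1 : (std_normal n).-integrable setT (fun z => (dotV (W *m z) (W *m z))%:E).
  apply/integrableP; split.
    by apply/measurable_EFinP; apply: measurable_dotV; exact: measurable_cV_mulmx.
  under eq_integral do rewrite gee0_abs ?lee_fin ?dotV_ge0//.
  by rewrite integral_dotV_mulmx ltry.
have I2 j : (std_normal n).-integrable setT (EFin \o h e j).
  by have [] := integral_std_normal_stein_field A (centering_mx d *m x) j e0.
have E2 j : (\int[std_normal n]_z (h e j z)%:E = 0)%E.
  by have [] := integral_std_normal_stein_field A (centering_mx d *m x) j e0.
have I3 : (std_normal n).-integrable setT (fun z => ((q z + 1)^-1)%:E).
  apply: (@le_integrable _ _ R (std_normal n) setT measurableT _ (cst 1%E)).
  - by apply/measurable_EFinP; exact: mqV.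
  - move=> z _; rewrite !abse_EFin lee_fin normr1 ger0_norm ?invr_ge0 ?addr_ge0//.
    by rewrite invf_le1 ?ltr_wpDl// lerDr.
  - exact: finite_measure_integrable_cst.
have I2s : (std_normal n).-integrable setT (fun z => \sum_j (h e j z)%:E)%E.
  by apply: integrable_sum => // j _; exact: I2.
apply: (@le_trans _ _ (\int[std_normal n]_z ((dotV (W *m z) (W *m z))%:E +
   (- (2 * c * s))%:E * (\sum_j (h e j z)%:E) - ((c * s) ^+ 2)%:E * ((q z + 1)^-1)%:E))%E).
  apply: ge0_le_integral => //.
  - by move=> z _; rewrite lee_fin dotV_ge0.
  - by apply/measurable_EFinP; apply: mF; exact: ltW.
  - apply: (measurable_int (std_normal n)).
    apply: integrableB => //; last exact: integrableZl.
    by apply: integrableD => //; exact: integrableZl.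
  - by move=> z _; rewrite sumEFin lee_fin; exact: F_le.
rewrite integralB//=; last 2 first.
- by apply: integrableD => //; exact: integrableZl.
- exact: integrableZl.
rewrite integralD//=; last exact: integrableZl.
rewrite !integralZl//= integral_sum// integral_dotV_mulmx WW mxtrace_scalar.
by rewrite big1// mule0 adde0 mulr_natl.
Qed.

(** The bound on the regularized risk lies below d s by a fixed positive amount, so strictness
    survives the limit e -> 0. *)
Lemma james_stein_risk_lt :
  (\int[std_normal n]_z (l2norm (m_a sigma (x + W *m z) - x) ^+ 2)%:E <
   (d%:R * sigma ^+ 2)%:E)%E.
Proof.
have K0 := @integral_gt0 _ _ (std_normal n) (fun z => (q z + 1)^-1).
have {}K0 : (0 < \int[std_normal n]_z ((q z + 1)^-1)%:E)%E.
  apply: K0; first exact: mqV.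
  by move=> z; rewrite invr_gt0 ltr_wpDl.
set K := (\int[_]_z _)%E in K0.
set B := ((d%:R * s)%:E - ((c * s) ^+ 2)%:E * K)%E.
have Bd : (B < (d%:R * s)%:E)%E.
  (* K is treated as an arbitrary positive extended real; if it were infinite, B would be -oo. *)
  rewrite /B; clearbody K; clear B; case: K K0 => [r||]//; last first.
    by rewrite gt0_muley ?lte_fin ?exprn_gt0 ?mulr_gt0//= ltNyr.
  rewrite lte_fin => r0; rewrite -EFinM -EFinB lte_fin gtrBl.
  by rewrite mulr_gt0// exprn_gt0// mulr_gt0.
apply: le_lt_trans Bd.
have limF z : (F n.+1%:R^-1 z)%:E @[n --> \oo] --> (F 0 z)%:E.
  apply: cvg_EFin; first exact: nearW.
  (* Where q = 0, the factor 1/(q + e) blows up, but v = 0 makes the loss constant in e. Elsewhere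
     inversion is continuous at q. *)
  have [q0|q0] := eqVneq (q z) 0.
    have v0 : v z = 0 by apply/eqP; rewrite -dotV_eq0; apply/eqP.
    rewrite /comp /F v0; under eq_fun do rewrite /= scaler0.
    rewrite scaler0; exact: cvg_cst.
  have k : (fun n : nat => c * s / (q z + n.+1%:R^-1)) @ \oo --> c * s / (q z + 0).
    apply: cvgM; first exact: cvg_cst.
    apply: cvgV; first by rewrite addr0.
    apply: cvgD; [exact: cvg_cst|exact: cvg_harmonic].
  rewrite /comp /=; under eq_fun do rewrite FE.
  rewrite FE; apply: cvgD; first apply: cvgD; first exact: cvg_cst.
    apply: cvgM; last exact: cvg_cst.
    by apply: cvgM; [exact: cvg_cst|apply: cvgN; exact: k].
  by apply: cvgM; [apply: cvgM; exact: k|exact: cvg_cst].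
have -> : (\int[std_normal n]_z (l2norm (m_a sigma (x + W *m z) - x) ^+ 2)%:E =
    \int[std_normal n]_z limn_einf (fun n => (F n.+1%:R^-1 z)%:E))%E.
  apply: eq_integral => z _; rewrite (cvg_limn_einf_sup (limF z)).1.
  by rewrite l2norm_dotV m_aE -vE addrAC [x + _]addrC addrK /F addr0.
(* Fatou's lemma along e = 1/(m + 1); each term is bounded by B, hence so is the lower limit. *)
apply: le_trans (fatou _ measurableT _ _) _.
- by move=> m; apply/measurable_EFinP; apply: mF; rewrite invr_ge0.
- by move=> m z _; rewrite lee_fin dotV_ge0.
rewrite limn_einf_lim; apply: lime_le; first exact: is_cvg_einfs.
apply: nearW => m; apply: (@le_trans _ _ (\int[std_normal n]_z (F m.+1%:R^-1 z)%:E)%E).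
  by apply: ereal_inf_lbound; exists m => /=.
apply: integral_F_le; first by rewrite invr_gt0.
by rewrite invf_le1 ?ler1n.
Qed.

End Risk.

End JamesStein.

(** * Risks of the three mechanisms *)

Section Risks.
Context {R : realType} {X : Type} {n p : nat}.
Variable theta : n.-tuple X -> 'cV[R]_p.

(** The square matrix [U V] has its transpose as a left inverse, hence also as a right inverse. The
    case on d + k = p makes it square by typing. *)
Lemma row_mx_orthonormal_complete d k (U : 'M[R]_(p, d)) (V : 'M[R]_(p, k)) :
  (d + k)%N = p -> U^T *m U = 1%:M -> V^T *m V = 1%:M -> U^T *m V = 0 ->
  U *m U^T + V *m V^T = 1%:M.
Proof.
move=> dk; case: _ / dk in U V * => UU VV UV.
have VU : V^T *m U = 0 by rewrite -[LHS]trmxK trmx_mul trmxK UV trmx0.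
rewrite -mul_row_col; apply: mulmx1C.
by rewrite mul_col_row UU UV VU VV -scalar_mx_block.
Qed.

Lemma sqrtmxP m (A : 'M[R]_m) :
  (exists B, psdmx B /\ B *m B = A) -> psdmx (sqrtmx A) /\ sqrtmx A *m sqrtmx A = A.
Proof. by move=> exB; apply: (@xgetPex _ 0 [set B | psdmx B /\ B *m B = A]). Qed.

(** The matrix sigma U U^T is a positive semidefinite root because U U^T is a projection; its
    existence makes the value chosen by [sqrtmx] meaningful. *)
Lemma sqrtmx_projP d (U : 'M[R]_(p, d)) (sigma : R) : 0 <= sigma ->
  U^T *m U = 1%:M -> let B := sqrtmx (sigma ^+ 2 *: (U *m U^T)) in
  B^T = B /\ B *m B = sigma ^+ 2 *: (U *m U^T).
Proof.
move=> s0 UU; have [|[BT _] BB] := @sqrtmxP _ (sigma ^+ 2 *: (U *m U^T)); last by [].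
exists (sigma *: (U *m U^T)); split; first split.
- by rewrite linearZ /= trmx_mul trmxK.
- move=> x; rewrite -scalemxAr -scalemxAl mxE mulr_ge0//.
  by have := dotV_ge0 (U^T *m x); rewrite /dotV trmx_mul trmxK !mulmxA.
- by rewrite -scalemxAl -scalemxAr scalerA -expr2 mulmxA -(mulmxA U) UU mulmx1.
Qed.

Lemma ge0_integral_gaussian (t : 'cV[R]_p) (Sigma : 'M[R]_p) (f : 'cV[R]_p -> \bar R) :
  measurable_fun setT f -> (forall y, 0 <= f y)%E ->
  (\int[distribution (multinormal 0 Sigma) (translate t)]_y f y =
   \int[std_normal p]_z f (t + sqrtmx Sigma *m z)%R)%E.
Proof.
move=> mf f0; rewrite ge0_integral_distribution// ge0_integral_distribution//.
- by apply: eq_integral => z _ /=; rewrite /translate /affine add0r.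
- exact: measurableT_comp.
- by move=> y; exact: f0.
Qed.

Lemma measurable_sqr_loss (t : 'cV[R]_p) :
  measurable_fun setT (fun y : 'cV[R]_p => (l2norm (y - t) ^+ 2)%:E).
Proof.
apply/measurable_EFinP; under eq_fun do rewrite l2norm_dotV.
by apply: measurable_dotV; exact: measurable_cV_add.
Qed.

Lemma L2_gaussian (M : mechanism) (Sigma : 'M[R]_p) S :
  M S = distribution (multinormal 0 Sigma) (translate (theta S)) ->
  (sqrtmx Sigma)^T = sqrtmx Sigma -> sqrtmx Sigma *m sqrtmx Sigma = Sigma ->
  L2 theta M S = (\tr Sigma)%:E.
Proof.
move=> MS BT BB; rewrite /L2 unlock MS ge0_integral_gaussian; last 2 first.
- exact: measurable_sqr_loss.
- by move=> y; rewrite lee_fin sqr_ge0.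
under eq_integral do rewrite l2norm_dotV addrAC subrr add0r.
by rewrite integral_dotV_mulmx BT BB.
Qed.

Lemma L2_M_r d (U : 'M[R]_(p, d)) (sigma : R) S : 0 <= sigma ->
  U^T *m U = 1%:M -> L2 theta (M_r theta U sigma) S = (d%:R * sigma ^+ 2)%:E.
Proof.
move=> s0 UU; have [BT BB] := sqrtmx_projP s0 UU.
rewrite (L2_gaussian (erefl _) BT BB) linearZ /= mxtrace_mulC UU mxtrace1.
by rewrite mulrC.
Qed.

(** The full Gaussian mechanism is the rank-deficient one with U the identity. *)
Lemma L2_M_G (sigma : R) S : 0 <= sigma ->
  L2 theta (M_G theta sigma) S = (p%:R * sigma ^+ 2)%:E.
Proof.
move=> s0; rewrite -(@L2_M_r _ 1%:M sigma S s0) ?mulmx1 ?trmx1//.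
by rewrite /L2 /M_r trmx1 mulmx1.
Qed.

Lemma L2_M_rJS_lt d k (U : 'M[R]_(p, d)) (U1 : 'M[R]_(p, k)) (sigma : R) S :
  0 < sigma -> U^T *m U = 1%:M -> U *m U^T + U1 *m U1^T = 1%:M -> (4 <= d)%N ->
  (L2 theta (M_rJS theta U U1 sigma) S < (d%:R * sigma ^+ 2)%:E)%E.
Proof.
move=> s0 UU UU1 d4; have [BT BB] := sqrtmx_projP (ltW s0) UU.
set B := sqrtmx _ in BT BB.
(* The noise seen in the coordinates of U is U^T B z, whose covariance is isotropic, as the
   James-Stein bound requires. *)
have WW : (U^T *m B) *m (U^T *m B)^T = (sigma ^+ 2)%:M.
  rewrite trmx_mul trmxK BT mulmxA -(mulmxA U^T) BB -scalemxAr -scalemxAl.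
  by rewrite mulmxA UU mul1mx UU scalemx1.
apply: le_lt_trans (james_stein_risk_lt (U^T *m theta S) d4 s0 WW).
have mL := measurable_sqr_loss (theta S).
rewrite /L2 unlock ge0_integral_distribution//; last first.
  by move=> y; rewrite lee_fin sqr_ge0.
rewrite ge0_integral_gaussian; last 2 first.
- by apply: measurableT_comp => //.
- by move=> y; rewrite lee_fin sqr_ge0.
rewrite le_eqVlt; apply/orP; left; apply/eqP; apply: eq_integral => z _ /=.
rewrite /rJS_post -/B [U^T *m (_ + _)]mulmxDr [U^T *m (B *m z)]mulmxA.
set y := m_a _ _.
(* By U U^T + U1 U1^T = I the error has no component along U1; U then preserves its norm, which
   leaves the loss of [m_a]. *)
have -> : U1 *m U1^T *m theta S + U *m y - theta S = U *m (y - U^T *m theta S).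
  rewrite -{2}(mul1mx (theta S)) -UU1 mulmxDl mulmxBr mulmxA.
  by rewrite [X in _ - X]addrC opprD addrACA subrr add0r.
by rewrite !l2norm_dotV dotV_mulmxl mulmxA UU mul1mx.
Qed.

End Risks.

(** * Comparison of the risks *)

Lemma orthonormal_basis_orthocomp (R : realType) p d k (V : {vspace 'cV[R]_p})
    (U : 'M[R]_(p, d)) (U1 : 'M[R]_(p, k)) :
  orthonormal_basis U V -> orthonormal_basis U1 (orthocomp V) ->
  U^T *m U1 = 0.
Proof.
move=> [bU _] [bU1 _]; apply/matrixP => i j; rewrite [RHS]mxE.
have iU : col i U \in V.
  by apply: (basis_mem bU); apply/mapP; exists i => //; rewrite mem_enum.
have jU1 : col j U1 \in orthocomp V.
  by apply: (basis_mem bU1); apply/mapP; exists j => //; rewrite mem_enum.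
have /mem_orthocomp/(_ _ iU) UU1 := jU1.
transitivity (((col i U)^T *m col j U1) 0 0); last by rewrite UU1 mxE.
by rewrite !mxE; apply: eq_bigr => l _; rewrite !mxE.
Qed.

Theorem theorem6 (R : realType) (X : Type) (n p : nat)
    (theta : n.-tuple X -> 'cV[R]_p) (mu Delta2 sigma : R)
    (Utheta : 'M[R]_(p, sensitivity_dim theta))
    (U1 : 'M[R]_(p, p - sensitivity_dim theta))
    (hmu : 0 < mu)
    (hrank : (sensitivity_dim theta < p)%N)
    (hDelta2 : l2_sensitivity theta = Delta2%:E)
    (hDelta2_gt0 : 0 < Delta2)
    (hUtheta : orthonormal_basis Utheta (sensitivity_span theta))
    (hU1 : orthonormal_basis U1 (orthocomp (sensitivity_span theta)))
    (hsigma : sigma = Delta2 / mu) :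
  strictly_dominates theta (M_r theta Utheta sigma) (M_G theta sigma) /\
  ((4 <= sensitivity_dim theta)%N ->
    strictly_dominates theta (M_rJS theta Utheta U1 sigma)
      (M_r theta Utheta sigma) /\
    strictly_dominates theta (M_rJS theta Utheta U1 sigma) (M_G theta sigma)).
Proof.
have s0 : 0 < sigma by rewrite hsigma divr_gt0.
have UU := hUtheta.2; have U11 := hU1.2.
have UU1 : Utheta *m Utheta^T + U1 *m U1^T = 1%:M.
  apply: row_mx_orthonormal_complete => //; first by rewrite subnKC// ltnW.
  exact: orthonormal_basis_orthocomp hUtheta hU1.
have rG S : (L2 theta (M_r theta Utheta sigma) S < L2 theta (M_G theta sigma) S)%E.
  rewrite L2_M_r ?(ltW s0)// L2_M_G ?(ltW s0)// lte_fin.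
  (* Rank deficiency makes the comparison of the two dimensions strict. *)
  by rewrite ltr_pM2r ?exprn_gt0// ltr_nat.
split=> // d4.
have JSr S : (L2 theta (M_rJS theta Utheta U1 sigma) S <
    L2 theta (M_r theta Utheta sigma) S)%E.
  by rewrite [ltRHS]L2_M_r ?(ltW s0)//; exact: L2_M_rJS_lt.
by split=> S //; exact: lt_trans (JSr S) (rG S).
Qed.
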